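(* Let $T>0$ and $0<\alpha<1$. Let $K(t,s)$ be a real-valued function that is continuous on $\{(t,s)\in\mathbb{R}^2 : s\le t\}\cup\{(t,s)\in\mathbb{R}^2 : t\le s\le 0\}$, and let $a:\mathbb{R}\to\mathbb{R}$ be continuous with $a(0)\neq 0$. Suppose there exist $\varepsilon\in(0,1)$, a continuous function $l$ on $[-T,T]$ and a constant $q<1$ such that for all $t\in[-T,T]$: (1) $|a(t)-a(0)|\le l(t)\,|t|^{\varepsilon}$; (2) $|a(t)|\,|\alpha|^{\varepsilon}\le q\,|a(0)|$. Let $A$ be the bounded linear operator on $C_{[-T,T]}$ defined by $$(Ax)(t)=\int_0^t K(t,s)\,x(s)\,ds+a(t)\,x(\alpha t),\qquad |t|\le T.$$ Then for every $n=0,1,2,\dots$ the number $\lambda_n=a(0)\alpha^n$ is an eigenvalue of $A$, and $t^n$ is an asymptotic approximation of a corresponding eigenfunction as $t\to 0$: there is an eigenfunction $\varphi_n\in C_{[-T,T]}$ of $A$ for the eigenvalue $\lambda_n$ with $\varphi_n(t)\sim t^n$ as $t\to0$.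
   Context: $C_{[-T,T]}$ denotes the Banach space of continuous real-valued functions on $[-T,T]$. A number $\lambda$ is called an eigenvalue of $A$ if the equation $\lambda x(t)=\int_0^t K(t,s)x(s)\,ds+a(t)x(\alpha t)$, $|t|\le T$, has a nontrivial (not identically zero) solution $x\in C_{[-T,T]}$; such a solution is called a corresponding eigenfunction. The notation $\varphi(t)\sim t^n$ as $t\to 0$ means $\varphi(t)/t^n\to 1$ as $t\to 0$, $t\neq 0$. For $t<0$ the integral is the oriented integral $\int_0^t=-\int_t^0$. *)

(* Defs.v *)
From Stdlib Require Import Reals.
From Coquelicot Require Import Coquelicot.
Open Scope R_scope.

Definition sym_interval (T t : R) : Prop := - T <= t <= T.

(* An element of the space C_[-T,T] is represented by a total function R -> R
   whose restriction to [-T,T] is continuous (one-sidedly at the endpoints);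
   its values outside [-T,T] play no role. *)
Definition in_C (T : R) (x : R -> R) : Prop := continuous_on (sym_interval T) x.

Definition kernel_domain (p : R * R) : Prop :=
  snd p <= fst p \/ (fst p <= snd p /\ snd p <= 0).

(* [RInt] is oriented: RInt f 0 t = - RInt f t 0, as required for t < 0. *)
Definition opA (K : R -> R -> R) (a : R -> R) (alpha : R) (x : R -> R) (t : R) : R :=
  RInt (fun s => K t s * x s) 0 t + a t * x (alpha * t).

Definition is_eigenfunction (T : R) (A : (R -> R) -> R -> R) (lambda : R)
    (x : R -> R) : Prop :=
  in_C T x /\
  (exists t, sym_interval T t /\ x t <> 0) /\
  (forall t, sym_interval T t -> lambda * x t = A x t).

Definition is_eigenvalue (T : R) (A : (R -> R) -> R -> R) (lambda : R) : Prop :=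
  exists x, is_eigenfunction T A lambda x.

(* |t|^e for e > 0.  The case t = 0 is separate because Rpower 0 e = 1. *)
Definition abs_power (t e : R) : R :=
  if Req_EM_T t 0 then 0 else Rpower (Rabs t) e.

(* phi(t) ~ t^n as t -> 0: [is_lim] at 0 is the limit over t <> 0. *)
Definition equiv_pow_at_0 (phi : R -> R) (n : nat) : Prop :=
  is_lim (fun t => phi t / t ^ n) 0 1.

(* Main.v *)
Require Import Defs.
From Stdlib Require Import Reals Lra Lia.
From Coquelicot Require Import Coquelicot.
Open Scope R_scope.

(** Put lam = a(0) alpha^n.  An eigenfunction for lam is a fixed point of
    (1/lam) A, and t^n nearly is one: by the Hoelder condition on a at 0,
    A t^n - lam t^n = O(|t|^(n+eps)) ([unit_op_pow_defect]).  It remains to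
    correct t^n by something of that order, and on functions of that order
    (1/lam) A is a contraction.  Indeed, for the norm with weight
    w(t) = |t|^(n+eps) exp(mu |t|), the dilation term a(t) x(alpha t) gains
    alpha^(n+eps), so the bound |a(t)| alpha^eps <= q |a(0)| makes its norm,
    relative to |lam|, at most q < 1 ([dilation_weight_bound]), while the
    Volterra term has norm O(1/mu) ([volterra_weight_bound]) and is made small
    by the choice of mu.

    Hence the Picard iterates of (1/lam) A starting at t^n converge locally
    uniformly to a continuous fixed point phi with |phi - t^n| <= C w
    ([weighted_contraction_fixed_point], [unit_op_eigenfunction]).  Since w is
    o(|t|^n), this gives phi ~ t^n ([equiv_pow_of_weight_bound]), and in
    particular phi is not identically zero.

    The analysis is carried out on the whole line: clamping the variables
    to [-T,T] extends a, and K along the segments (t, t u), 0 <= u <= 1, to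
    continuous functions, the kernel being bounded as well, without
    changing A on [-T,T] ([opA_clamped]). *)

(** * Fixed points of contractions for a weighted sup norm *)

Lemma geometric_small (C rho e : R) :
  0 <= C -> 0 <= rho < 1 -> 0 < e -> exists k, C * rho ^ k < e.
Proof.
  intros HC Hrho He.
  destruct (pow_lt_1_zero rho) with (y := e / (C + 1)) as [N HN].
  - rewrite Rabs_pos_eq; lra.
  - apply Rdiv_lt_0_compat; lra.
  - exists N. specialize (HN N (le_n N)).
    assert (Hp : 0 <= rho ^ N) by (apply pow_le; lra).
    rewrite Rabs_pos_eq in HN by exact Hp.
    apply (Rmult_lt_compat_l (C + 1)) in HN; [|lra].
    replace ((C + 1) * (e / (C + 1))) with e in HN by (field; lra).
    nra.
Qed.

Lemma geometric_limit (u : nat -> R) (E rho : R) :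
  0 <= rho < 1 ->
  (forall k, Rabs (u (S k) - u k) <= E * rho ^ k) ->
  forall k, Rabs (real (Lim_seq u) - u k) <= E / (1 - rho) * rho ^ k.
Proof.
  intros Hrho Hu.
  set (C := E / (1 - rho)).
  assert (HE : E = C * (1 - rho)) by (unfold C; field; lra).
  assert (HE0 : 0 <= E).
  { pose proof (Hu 0%nat) as H. pose proof (Rabs_pos (u 1%nat - u 0%nat)).
    simpl in H. lra. }
  assert (HC : 0 <= C).
  { unfold C, Rdiv. apply Rmult_le_pos; [lra|].
    left. apply Rinv_0_lt_compat. lra. }
  (* The telescoped form of the bound goes through the induction on m. *)
  assert (Hkm : forall k m, Rabs (u (k + m)%nat - u k) <= C * (rho ^ k - rho ^ (k + m))).
  { intros k m. induction m as [|m IH].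
    - rewrite Nat.add_0_r, Rminus_diag, Rabs_R0. lra.
    - rewrite <- plus_n_Sm.
      replace (u (S (k + m)) - u k)
        with ((u (S (k + m)) - u (k + m)%nat) + (u (k + m)%nat - u k)) by ring.
      eapply Rle_trans; [apply Rabs_triang|].
      pose proof (Hu (k + m)%nat) as H. rewrite HE in H.
      simpl. lra. }
  assert (Hb : forall k m, (k <= m)%nat -> Rabs (u m - u k) <= C * rho ^ k).
  { intros k m Hle. replace m with (k + (m - k))%nat by lia.
    eapply Rle_trans; [apply Hkm|].
    apply Rmult_le_compat_l; [exact HC|].
    pose proof (pow_le rho (k + (m - k)) (proj1 Hrho)). lra. }
  assert (Hfin : ex_finite_lim_seq u).
  { apply ex_lim_seq_cauchy_corr. intros e.
    destruct (geometric_small C rho (e / 2) HC Hrho) as [N HN].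
    { pose proof (cond_pos e). lra. }
    exists N. intros n m Hn Hm.
    pose proof (Hb N n Hn) as H1. pose proof (Hb N m Hm) as H2.
    rewrite Rabs_minus_sym in H2.
    replace (u n - u m) with ((u n - u N) + (u N - u m)) by ring.
    eapply Rle_lt_trans; [apply Rabs_triang|]. lra. }
  apply Lim_seq_correct' in Hfin.
  intros k. change (Rbar_le (Finite (Rabs (Lim_seq u - u k))) (Finite (C * rho ^ k))).
  apply is_lim_seq_le with (u := fun m => Rabs (u (k + m)%nat - u k))
    (v := fun _ => C * rho ^ k).
  - intros m. apply Hb. lia.
  - apply (is_lim_seq_abs _ (Finite (Lim_seq u - u k))).
    apply is_lim_seq_minus'; [|apply is_lim_seq_const].
    apply (is_lim_seq_ext (fun m => u (m + k)%nat)).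
    { intros m. f_equal. lia. }
    apply is_lim_seq_incr_n. exact Hfin.
  - apply is_lim_seq_const.
Qed.

Lemma continuous_R_eps (f : R -> R) (t : R) :
  continuous f t <->
  (forall e : posreal, exists d : posreal,
     forall s, Rabs (s - t) < d -> Rabs (f s - f t) < e).
Proof.
  split.
  - intros H e. apply (proj1 (filterlim_locally f (f t))) with (eps := e) in H.
    destruct H as [d Hd]. exists d. exact Hd.
  - intros H. apply (proj2 (filterlim_locally f (f t))). intros e.
    destruct (H e) as [d Hd]. exists d. exact Hd.
Qed.

(** Since [w] is bounded on bounded sets, the hypothesis says that [x k] tends
    to [phi] locally uniformly, and a locally uniform limit of continuous
    functions is continuous. *)
Lemma weighted_limit_continuous (x : nat -> R -> R) (phi w : R -> R) (C rho : R) :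
  0 <= C -> 0 <= rho < 1 ->
  (forall r, exists W, forall t, Rabs t <= r -> w t <= W) ->
  (forall k t, continuous (x k) t) ->
  (forall k t, Rabs (phi t - x k t) <= C * rho ^ k * w t) ->
  forall t, continuous phi t.
Proof.
  intros HC Hrho Hw Hx Hphi t. apply continuous_R_eps. intros e.
  destruct (Hw (Rabs t + 1)) as [W HW].
  assert (HW' : forall s, Rabs s <= Rabs t + 1 -> w s <= Rmax 0 W).
  { intros s Hs. eapply Rle_trans; [apply (HW s Hs)|apply Rmax_r]. }
  pose proof (Rmax_l 0 W) as HW0. revert HW' HW0. generalize (Rmax 0 W).
  clear W HW. intros W HW HW0.
  pose proof (cond_pos e) as He.
  (* The e/3 argument, on the interval |s| <= |t| + 1. *)
  destruct (geometric_small (C * W) rho (e / 3)) as [k Hk]; [nra|exact Hrho|lra|].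
  assert (Hk' : forall s, Rabs s <= Rabs t + 1 -> Rabs (phi s - x k s) < e / 3).
  { intros s Hs. eapply Rle_lt_trans; [apply Hphi|].
    pose proof (pow_le rho k (proj1 Hrho)).
    eapply Rle_lt_trans; [|exact Hk].
    replace (C * W * rho ^ k) with (C * rho ^ k * W) by ring.
    apply Rmult_le_compat_l; [nra|]. apply HW, Hs. }
  assert (He3 : 0 < e / 3) by lra.
  destruct (proj1 (continuous_R_eps (x k) t) (Hx k t) (mkposreal _ He3)) as [d Hd].
  simpl in Hd.
  assert (Hd1 : 0 < Rmin d 1) by (apply Rmin_pos; [apply cond_pos|lra]).
  exists (mkposreal _ Hd1). simpl. intros s Hs.
  assert (H1 : Rabs (s - t) < d) by (eapply Rlt_le_trans; [exact Hs|apply Rmin_l]).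
  assert (H2 : Rabs (s - t) < 1) by (eapply Rlt_le_trans; [exact Hs|apply Rmin_r]).
  assert (H3 : Rabs s <= Rabs t + 1).
  { pose proof (Rabs_triang (s - t) t) as H. replace (s - t + t) with s in H by ring. lra. }
  pose proof (Hk' s H3) as Ha. pose proof (Hd s H1) as Hb.
  assert (Hc : Rabs (phi t - x k t) < e / 3) by (apply Hk'; lra).
  apply Rabs_def2 in Ha. apply Rabs_def2 in Hb. apply Rabs_def2 in Hc.
  apply Rabs_def1; lra.
Qed.

(** Banach's fixed point theorem for the distance sup |x - y| / w, which may be
    infinite: the Picard iterates and their limit stay at finite distance from
    [x0] because the first increment [P x0 - x0] is dominated by [w].  The
    contraction bound applied to the limit and to the k-th iterate shows that
    [P phi] and [phi] are both within O(rho^k) of the next iterate, hence equal;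
    for an integral operator this replaces passing to the limit under the
    integral. *)
Lemma weighted_contraction_fixed_point
    (P : (R -> R) -> R -> R) (w x0 : R -> R) (rho D : R) :
  0 <= rho < 1 ->
  (forall t, 0 <= w t) ->
  (forall r, exists W, forall t, Rabs t <= r -> w t <= W) ->
  (forall x, (forall t, continuous x t) -> forall t, continuous (P x) t) ->
  (forall x y E, (forall t, continuous x t) -> (forall t, continuous y t) ->
     0 <= E -> (forall t, Rabs (x t - y t) <= E * w t) ->
     forall t, Rabs (P x t - P y t) <= rho * E * w t) ->
  (forall t, continuous x0 t) ->
  0 <= D ->
  (forall t, Rabs (P x0 t - x0 t) <= D * w t) ->
  exists phi, (forall t, continuous phi t) /\
    (forall t, P phi t = phi t) /\
    (forall t, Rabs (phi t - x0 t) <= D / (1 - rho) * w t).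
Proof.
  intros Hrho Hw0 Hw HPc HP Hx0 HD Hfirst.
  pose (x := fix x (k : nat) : R -> R := match k with O => x0 | S j => P (x j) end).
  assert (Hxc : forall k t, continuous (x k) t).
  { intros k. induction k as [|k IH]; [exact Hx0|exact (HPc _ IH)]. }
  assert (Hstep : forall k t, Rabs (x (S k) t - x k t) <= D * rho ^ k * w t).
  { intros k. induction k as [|k IH]; intros t.
    - simpl. rewrite Rmult_1_r. apply Hfirst.
    - change (Rabs (P (x (S k)) t - P (x k) t) <= D * rho ^ S k * w t).
      replace (D * rho ^ S k) with (rho * (D * rho ^ k)) by (simpl; ring).
      apply HP; [apply Hxc|apply Hxc| |exact IH].
      apply Rmult_le_pos; [exact HD|apply pow_le, Hrho]. }
  set (C := D / (1 - rho)).
  assert (HC : 0 <= C).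
  { unfold C, Rdiv. apply Rmult_le_pos; [lra|].
    left. apply Rinv_0_lt_compat. lra. }
  pose (phi := fun t => real (Lim_seq (fun k => x k t))).
  assert (Hphi : forall k t, Rabs (phi t - x k t) <= C * rho ^ k * w t).
  { intros k t.
    replace (C * rho ^ k * w t) with (D * w t / (1 - rho) * rho ^ k)
      by (unfold C; field; lra).
    apply (geometric_limit (fun k => x k t)); [exact Hrho|].
    intros j. replace (D * w t * rho ^ j) with (D * rho ^ j * w t) by ring.
    apply Hstep. }
  assert (Hphic : forall t, continuous phi t).
  { exact (weighted_limit_continuous x phi w C rho HC Hrho Hw Hxc Hphi). }
  exists phi. split; [exact Hphic|split].
  - intros t. apply Rminus_diag_uniq, Rabs_eq_0, Rle_antisym; [|apply Rabs_pos].
    apply le_epsilon. intros e He. rewrite Rplus_0_l.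
    destruct (geometric_small (2 * C * w t) rho e) as [k Hk]; [|exact Hrho|exact He|].
    { pose proof (Hw0 t). apply Rmult_le_pos; lra. }
    assert (Hp : 0 <= C * rho ^ k) by (apply Rmult_le_pos; [exact HC|apply pow_le, Hrho]).
    pose proof (HP phi (x k) (C * rho ^ k) Hphic (Hxc k) Hp (Hphi k) t) as H1.
    pose proof (Hphi (S k) t) as H2. rewrite Rabs_minus_sym in H2.
    change (x (S k)) with (P (x k)) in H2.
    replace (P phi t - phi t) with ((P phi t - P (x k) t) + (P (x k) t - phi t)) by ring.
    eapply Rle_trans; [apply Rabs_triang|]. simpl in H2.
    assert (Hq : 0 <= C * rho ^ k * w t) by (apply Rmult_le_pos; [exact Hp|apply Hw0]).
    nra.
  - intros t. pose proof (Hphi 0%nat t) as H. simpl in H. rewrite Rmult_1_r in H. exact H.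
Qed.

(** * Continuous functions of two variables *)

(** Around each point (t', u') uniform continuity keeps |h| within 1 of
    |h t' u'|.  Compactness applied to a gauge that is at most
    1 / (1 + |h t' u'|) then bounds all these values by one constant. *)
Lemma continuity_2d_bounded (h : R -> R -> R) (a b c d : R) :
  (forall t u, a <= t <= b -> c <= u <= d -> continuity_2d_pt h t u) ->
  exists M, forall t u, a <= t <= b -> c <= u <= d -> Rabs (h t u) <= M.
Proof.
  intros Hh.
  destruct (uniform_continuity_2d h a b c d Hh (mkposreal 1 Rlt_0_1)) as [delta Hdelta].
  simpl in Hdelta.
  assert (Hpos : forall t u, 0 < Rmin delta (/ (1 + Rabs (h t u)))).
  { intros t u. pose proof (Rabs_pos (h t u)).
    apply Rmin_pos; [apply cond_pos|apply Rinv_0_lt_compat; lra]. }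
  destruct (compactness_value_2d a b c d (fun t u => mkposreal _ (Hpos t u))) as [m Hm].
  simpl in Hm. pose proof (cond_pos m) as Hm0.
  exists (/ m). intros t u Ht Hu. apply Rnot_lt_le. intros Hlt.
  apply (Hm t u Ht Hu). intros (t' & u' & Ht' & Hu' & H1 & H2 & H3).
  assert (Hd1 : Rabs (t - t') < delta) by (eapply Rlt_le_trans; [exact H1|apply Rmin_l]).
  assert (Hd2 : Rabs (u - u') < delta) by (eapply Rlt_le_trans; [exact H2|apply Rmin_l]).
  assert (H4 : m <= / (1 + Rabs (h t' u'))) by (eapply Rle_trans; [exact H3|apply Rmin_r]).
  pose proof (Hdelta t' u' t u Ht' Hu' Ht Hu Hd1 Hd2) as H5.
  pose proof (Rabs_pos (h t' u')) as H6.
  apply Rinv_le_contravar in H4; [|exact Hm0]. rewrite Rinv_inv in H4.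
  pose proof (Rabs_triang (h t u - h t' u') (h t' u')) as H7.
  replace (h t u - h t' u' + h t' u') with (h t u) in H7 by ring. lra.
Qed.

Lemma continuity_2d_section (h : R -> R -> R) (t u : R) :
  continuity_2d_pt h t u -> continuous (h t) u.
Proof.
  intros Hh. apply continuous_R_eps. intros e.
  destruct (Hh e) as [d Hd]. exists d. intros v Hv. apply Hd; [|exact Hv].
  rewrite Rminus_diag, Rabs_R0. apply cond_pos.
Qed.

Lemma ex_RInt_section (h : R -> R -> R) (t a b : R) :
  (forall t u, continuity_2d_pt h t u) -> ex_RInt (h t) a b.
Proof.
  intros Hh. apply (ex_RInt_continuous (V := R_CompleteNormedModule)). intros u _.
  apply continuity_2d_section, Hh.
Qed.

Lemma continuous_RInt_unit_param (h : R -> R -> R) (t : R) :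
  (forall t u, continuity_2d_pt h t u) ->
  continuous (fun t => RInt (h t) 0 1) t.
Proof.
  intros Hh. apply continuous_R_eps. intros e.
  pose proof (cond_pos e) as He. assert (He2 : 0 < e / 2) by lra.
  destruct (uniform_continuity_2d_1d' h 0 1 t (fun u _ => Hh t u) (mkposreal _ He2))
    as [d Hd]. simpl in Hd. pose proof (cond_pos d) as Hd0.
  exists d. intros s Hs.
  assert (Hint : is_RInt (fun u => h s u - h t u) 0 1 (RInt (h s) 0 1 - RInt (h t) 0 1)).
  { apply (is_RInt_minus (h s) (h t)); apply (@RInt_correct R_CompleteNormedModule), ex_RInt_section, Hh. }
  apply Rle_lt_trans with ((1 - 0) * (e / 2)); [|lra].
  apply (norm_RInt_le_const (V := R_NormedModule)) with (fun u => h s u - h t u);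
    [lra| |exact Hint].
  intros u Hu. left. apply (Hd u t u s Hu); try exact Hu.
  - lra.
  - apply Rabs_def2 in Hs. lra.
  - rewrite Rminus_diag, Rabs_R0. exact Hd0.
Qed.

Lemma continuity_2d_integrand (h : R -> R -> R) (x : R -> R) :
  (forall t u, continuity_2d_pt h t u) -> (forall t, continuous x t) ->
  forall t u, continuity_2d_pt (fun t u => h t u * x (t * u)) t u.
Proof.
  intros Hh Hx t u. apply continuity_2d_pt_mult; [apply Hh|].
  apply (continuity_1d_2d_pt_comp x (fun t u => t * u)).
  - apply continuity_pt_filterlim, Hx.
  - apply continuity_2d_pt_mult; [apply continuity_2d_pt_id1|apply continuity_2d_pt_id2].
Qed.

(** * The power |t|^e and the weight *)

Lemma abs_power_nonneg (t e : R) : 0 <= abs_power t e.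
Proof.
  unfold abs_power. destruct (Req_EM_T t 0); [lra|]. left. apply exp_pos.
Qed.

Lemma abs_power_le (s t e : R) :
  0 <= e -> Rabs s <= Rabs t -> abs_power s e <= abs_power t e.
Proof.
  intros He Hst. pose proof (abs_power_nonneg t e) as Hp. revert Hp.
  unfold abs_power. destruct (Req_EM_T s 0) as [Hs|Hs]; [trivial|].
  pose proof (Rabs_pos_lt s Hs) as Hs'.
  destruct (Req_EM_T t 0) as [Ht|Ht].
  - rewrite Ht, Rabs_R0 in Hst. lra.
  - intros _. apply Rle_Rpower_l; lra.
Qed.

Lemma abs_power_mult (s t e : R) :
  abs_power (s * t) e = abs_power s e * abs_power t e.
Proof.
  unfold abs_power.
  destruct (Req_EM_T (s * t) 0) as [H|H]; destruct (Req_EM_T s 0) as [Hs|Hs];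
    destruct (Req_EM_T t 0) as [Ht|Ht]; subst; try ring.
  - apply Rmult_integral in H. tauto.
  - exfalso. apply H. ring.
  - exfalso. apply H. ring.
  - exfalso. apply H. ring.
  - rewrite Rabs_mult. symmetry. apply Rpower_mult_distr; apply Rabs_pos_lt; assumption.
Qed.

Lemma abs_power_small (e eta : R) :
  0 < e -> 0 < eta ->
  exists d : posreal, forall t, Rabs t < d -> abs_power t e <= eta.
Proof.
  intros He Heta.
  assert (Hd : 0 < Rpower eta (/ e)) by apply exp_pos.
  exists (mkposreal _ Hd). simpl. intros t Ht. unfold abs_power.
  destruct (Req_EM_T t 0) as [H|H]; [lra|].
  replace eta with (Rpower (Rpower eta (/ e)) e).
  - apply Rle_Rpower_l; [lra|]. pose proof (Rabs_pos_lt t H). lra.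
  - rewrite Rpower_mult, Rinv_l by lra. apply Rpower_1, Heta.
Qed.

(** In logarithmic form: ln|t| <= e ln|t| + |t|.  It lets the exponential
    factor of the weight absorb the missing power |t|^(1-e) also for large t. *)
Lemma Rabs_le_abs_power_exp (t e : R) :
  0 < e < 1 -> Rabs t <= abs_power t e * exp (Rabs t).
Proof.
  intros He. unfold abs_power. destruct (Req_EM_T t 0) as [H|H].
  - rewrite H, Rabs_R0. lra.
  - pose proof (Rabs_pos_lt t H) as Ht.
    unfold Rpower. rewrite <- exp_plus. rewrite <- (exp_ln (Rabs t)) at 1 by exact Ht.
    assert (Hln : ln (Rabs t) <= Rabs t).
    { pose proof (exp_ineq1_le (ln (Rabs t))) as Hi. rewrite exp_ln in Hi by exact Ht. lra. }
    assert (Hle : ln (Rabs t) <= e * ln (Rabs t) + Rabs t).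
    { destruct (Rle_dec 0 (ln (Rabs t))); nra. }
    destruct Hle as [Hlt|Heq]; [left; apply exp_increasing, Hlt|rewrite <- Heq; lra].
Qed.

(** The power |t|^(n+eps) makes the dilation x(alpha t) contract by the extra
    factor alpha^eps; the exponential makes the Volterra part small, as in
    Bielecki's norm. *)
Definition weight (n : nat) (eps mu t : R) : R :=
  Rabs t ^ n * abs_power t eps * exp (mu * Rabs t).

Lemma weight_nonneg (n : nat) (eps mu t : R) : 0 <= weight n eps mu t.
Proof.
  unfold weight. pose proof (exp_pos (mu * Rabs t)).
  pose proof (pow_le (Rabs t) n (Rabs_pos t)). pose proof (abs_power_nonneg t eps).
  apply Rmult_le_pos; [nra|lra].
Qed.

Lemma exp_le (x y : R) : x <= y -> exp x <= exp y.
Proof.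
  intros [H|H]; [left; apply exp_increasing, H|rewrite H; lra].
Qed.

Lemma weight_scaled_le (n : nat) (eps mu s t : R) :
  0 <= eps -> Rabs s <= Rabs t ->
  weight n eps mu s <= Rabs t ^ n * abs_power t eps * exp (mu * Rabs s).
Proof.
  intros He Hst. unfold weight.
  apply Rmult_le_compat_r; [left; apply exp_pos|].
  apply Rmult_le_compat.
  - apply pow_le, Rabs_pos.
  - apply abs_power_nonneg.
  - apply pow_incr. split; [apply Rabs_pos|exact Hst].
  - apply abs_power_le; assumption.
Qed.

Lemma weight_locally_bounded (n : nat) (eps mu : R) :
  0 <= eps -> 0 <= mu ->
  forall r, exists W, forall t, Rabs t <= r -> weight n eps mu t <= W.
Proof.
  intros He Hmu r.
  exists (Rabs r ^ n * abs_power r eps * exp (mu * Rabs r)).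
  intros t Ht. pose proof (Rle_abs r) as Hr.
  eapply Rle_trans; [apply weight_scaled_le with (t := r); lra|].
  apply Rmult_le_compat_l.
  - apply Rmult_le_pos; [apply pow_le, Rabs_pos|apply abs_power_nonneg].
  - apply exp_le, Rmult_le_compat_l; lra.
Qed.

(** * The operator on the whole line *)

(** The substitution s = t u turns the oriented integral from 0 to t into t times
    an integral over [0,1], so that both signs of t are treated alike; [h t u]
    stands for K(t, t u). *)
Definition unit_op (h : R -> R -> R) (b : R -> R) (alpha : R) (x : R -> R) (t : R) : R :=
  t * RInt (fun u => h t u * x (t * u)) 0 1 + b t * x (alpha * t).

Lemma unit_op_continuous (h : R -> R -> R) (b : R -> R) (alpha : R) (x : R -> R) :
  (forall t u, continuity_2d_pt h t u) -> (forall t, continuous b t) ->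
  (forall t, continuous x t) -> forall t, continuous (unit_op h b alpha x) t.
Proof.
  intros Hh Hb Hx t. unfold unit_op.
  apply (continuous_plus (fun t => t * RInt (fun u => h t u * x (t * u)) 0 1)
           (fun t => b t * x (alpha * t))).
  - apply (continuous_mult (fun t => t) (fun t => RInt (fun u => h t u * x (t * u)) 0 1)).
    + apply continuous_id.
    + apply (continuous_RInt_unit_param (fun t u => h t u * x (t * u))).
      apply continuity_2d_integrand; assumption.
  - apply (continuous_mult b (fun t => x (alpha * t))); [apply Hb|].
    apply (continuous_comp (fun t => alpha * t) x); [|apply Hx].
    apply (continuous_scal_r alpha (fun t : R => t)), continuous_id.
Qed.

Lemma unit_op_minus (h : R -> R -> R) (b : R -> R) (alpha : R) (x y : R -> R) (t : R) :
  (forall t u, continuity_2d_pt h t u) ->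
  (forall t, continuous x t) -> (forall t, continuous y t) ->
  unit_op h b alpha x t - unit_op h b alpha y t
  = unit_op h b alpha (fun t => x t - y t) t.
Proof.
  intros Hh Hx Hy. unfold unit_op.
  assert (HI : RInt (fun u => h t u * (x (t * u) - y (t * u))) 0 1
    = RInt (fun u => h t u * x (t * u)) 0 1 - RInt (fun u => h t u * y (t * u)) 0 1).
  { apply is_RInt_unique.
    apply is_RInt_ext with (fun u => h t u * x (t * u) - h t u * y (t * u)).
    { intros u _. simpl. ring. }
    apply (is_RInt_minus (fun u => h t u * x (t * u)) (fun u => h t u * y (t * u)));
      apply (@RInt_correct R_CompleteNormedModule).
    - apply (ex_RInt_section (fun t u => h t u * x (t * u))), continuity_2d_integrand; assumption.
    - apply (ex_RInt_section (fun t u => h t u * y (t * u))), continuity_2d_integrand; assumption. }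
  rewrite HI. ring.
Qed.

(** With a = |t|, the integral of a exp(mu a u) over u in [0,1] is at most
    exp(mu a) / mu, so the norm of the Volterra part is O(1/mu) for the weight
    with parameter [mu]. *)
Lemma volterra_weight_bound (h : R -> R -> R) (z : R -> R) (n : nat) (eps mu M E t : R) :
  (forall t u, continuity_2d_pt h t u) -> (forall t, continuous z t) ->
  (forall t u, Rabs (h t u) <= M) ->
  0 <= eps -> 0 < mu -> 0 <= E ->
  (forall t, Rabs (z t) <= E * weight n eps mu t) ->
  Rabs (t * RInt (fun u => h t u * z (t * u)) 0 1) <= M / mu * E * weight n eps mu t.
Proof.
  intros Hh Hz HM He Hmu HE Hzw.
  assert (HM0 : 0 <= M) by (eapply Rle_trans; [apply Rabs_pos|apply (HM 0 0)]).
  set (A := Rabs t ^ n * abs_power t eps).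
  assert (HA : 0 <= A).
  { apply Rmult_le_pos; [apply pow_le, Rabs_pos|apply abs_power_nonneg]. }
  (* A primitive of the dominating integrand, meaningful for t = 0 as well. *)
  pose (G := fun u => M * E * A / mu * exp (mu * Rabs t * u)).
  assert (HG : is_RInt (fun u => M * E * A * Rabs t * exp (mu * Rabs t * u)) 0 1 (G 1 - G 0)).
  { apply (is_RInt_derive G).
    - intros u _. unfold G. auto_derive; [exact I|]. field. lra.
    - intros u _. apply (ex_derive_continuous (V := R_NormedModule)).
      auto_derive. exact I. }
  assert (Hint : is_RInt (fun u => t * (h t u * z (t * u))) 0 1
                   (t * RInt (fun u => h t u * z (t * u)) 0 1)).
  { apply (is_RInt_scal (fun u => h t u * z (t * u)) 0 1 t).
    apply (@RInt_correct R_CompleteNormedModule).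
    apply (ex_RInt_section (fun t u => h t u * z (t * u))), continuity_2d_integrand; assumption. }
  apply Rle_trans with (G 1 - G 0).
  - apply (norm_RInt_le (V := R_NormedModule)) with
      (fun u => t * (h t u * z (t * u)))
      (fun u => M * E * A * Rabs t * exp (mu * Rabs t * u)) 0 1;
      [lra| |exact Hint|exact HG].
    intros u Hu. change (Rabs (t * (h t u * z (t * u)))
      <= M * E * A * Rabs t * exp (mu * Rabs t * u)).
    rewrite !Rabs_mult. pose proof (Rabs_pos t) as Ht.
    assert (Hab : Rabs (t * u) = Rabs t * u).
    { rewrite Rabs_mult, (Rabs_pos_eq u); lra. }
    assert (Hw : Rabs (z (t * u)) <= E * (A * exp (mu * Rabs t * u))).
    { eapply Rle_trans; [apply Hzw|]. apply Rmult_le_compat_l; [exact HE|].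
      replace (mu * Rabs t * u) with (mu * Rabs (t * u)) by (rewrite Hab; ring).
      apply weight_scaled_le; [exact He|]. rewrite Hab. nra. }
    replace (M * E * A * Rabs t * exp (mu * Rabs t * u))
      with (Rabs t * (M * (E * (A * exp (mu * Rabs t * u))))) by ring.
    apply Rmult_le_compat_l; [exact Ht|].
    apply Rmult_le_compat; [apply Rabs_pos|apply Rabs_pos|apply HM|exact Hw].
  - unfold G, weight. fold A. rewrite Rmult_0_r, exp_0, Rmult_1_r, Rmult_1_r.
    assert (Hc : 0 <= M * E * A / mu).
    { unfold Rdiv. apply Rmult_le_pos; [|left; apply Rinv_0_lt_compat, Hmu].
      apply Rmult_le_pos; [apply Rmult_le_pos; assumption|exact HA]. }
    replace (M / mu * E * (A * exp (mu * Rabs t)))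
      with (M * E * A / mu * exp (mu * Rabs t)) by (field; lra).
    lra.
Qed.

(** The weight at alpha t is at most alpha^n alpha^eps times the weight at t, and
    the hypothesis on [b] turns alpha^eps |b t| into q |c|: relative to the
    eigenvalue c alpha^n the dilation part has norm at most q. *)
Lemma dilation_weight_bound (b : R -> R) (c alpha q : R) (z : R -> R)
    (n : nat) (eps mu E t : R) :
  0 < alpha < 1 -> 0 <= mu -> 0 <= E -> 0 <= q ->
  Rabs (b t) * abs_power alpha eps <= q * Rabs c ->
  (forall t, Rabs (z t) <= E * weight n eps mu t) ->
  Rabs (b t * z (alpha * t)) <= q * Rabs (c * alpha ^ n) * E * weight n eps mu t.
Proof.
  intros Ha Hmu HE Hq0 Hq Hz. rewrite Rabs_mult.
  pose proof (pow_lt alpha n (proj1 Ha)) as Han.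
  rewrite Rabs_mult, (Rabs_pos_eq (alpha ^ n)) by lra.
  assert (Hab : Rabs (alpha * t) = alpha * Rabs t).
  { rewrite Rabs_mult, (Rabs_pos_eq alpha); lra. }
  pose proof (Rabs_pos t) as Ht. pose proof (Rabs_pos (b t)) as Hbt.
  apply Rle_trans with (Rabs (b t) * (E * weight n eps mu (alpha * t))).
  { apply Rmult_le_compat_l; [exact Hbt|apply Hz]. }
  unfold weight. rewrite Hab, abs_power_mult, Rpow_mult_distr.
  apply Rle_trans with (Rabs (b t) * abs_power alpha eps *
    (alpha ^ n * E * (Rabs t ^ n * abs_power t eps * exp (mu * Rabs t)))).
  - replace (Rabs (b t) * (E * (alpha ^ n * Rabs t ^ n *
        (abs_power alpha eps * abs_power t eps) * exp (mu * (alpha * Rabs t)))))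
      with (Rabs (b t) * abs_power alpha eps *
        (alpha ^ n * E * (Rabs t ^ n * abs_power t eps * exp (mu * (alpha * Rabs t)))))
      by ring.
    apply Rmult_le_compat_l; [apply Rmult_le_pos; [exact Hbt|apply abs_power_nonneg]|].
    apply Rmult_le_compat_l; [nra|].
    apply Rmult_le_compat_l.
    + apply Rmult_le_pos; [apply pow_le, Ht|apply abs_power_nonneg].
    + apply exp_le, Rmult_le_compat_l; [exact Hmu|nra].
  - replace (q * (Rabs c * alpha ^ n) * E *
        (Rabs t ^ n * abs_power t eps * exp (mu * Rabs t)))
      with (q * Rabs c *
        (alpha ^ n * E * (Rabs t ^ n * abs_power t eps * exp (mu * Rabs t)))) by ring.
    apply Rmult_le_compat_r; [|exact Hq].
    apply Rmult_le_pos; [nra|]. apply (weight_nonneg n eps mu t).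
Qed.

(** On t^n the integral contributes O(|t|^(n+1)) and replacing [b t] by its value
    [c] at 0 costs O(|t|^(n+eps)); both are dominated by the weight.  This is
    where eps < 1 and the Hoelder condition at 0 enter. *)
Lemma unit_op_pow_defect (h : R -> R -> R) (b : R -> R) (c alpha M L eps mu : R)
    (n : nat) (t : R) :
  (forall t u, continuity_2d_pt h t u) ->
  (forall t u, Rabs (h t u) <= M) ->
  0 < alpha < 1 -> 0 < eps < 1 -> 1 <= mu ->
  Rabs (b t - c) <= L * abs_power t eps ->
  Rabs (unit_op h b alpha (fun t => t ^ n) t - c * alpha ^ n * t ^ n)
  <= (M + Rabs L) * weight n eps mu t.
Proof.
  intros Hh HM Ha He Hmu Hb. unfold unit_op.
  assert (HM0 : 0 <= M) by (eapply Rle_trans; [apply Rabs_pos|apply (HM 0 0)]).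
  assert (Hpc : forall s, continuous (fun t : R => t ^ n) s).
  { intros s. apply continuity_pt_filterlim, derivable_continuous_pt, derivable_pt_pow. }
  set (I1 := RInt (fun u => h t u * (t * u) ^ n) 0 1).
  pose proof (Rabs_pos t) as Ht. pose proof (pow_le (Rabs t) n Ht) as Htn.
  assert (HI : Rabs I1 <= M * Rabs t ^ n).
  { apply Rle_trans with ((1 - 0) * (M * Rabs t ^ n)); [|lra].
    apply (norm_RInt_le_const (V := R_NormedModule)) with (fun u => h t u * (t * u) ^ n);
      [lra| |].
    - intros u Hu. change (Rabs (h t u * (t * u) ^ n) <= M * Rabs t ^ n).
      rewrite Rabs_mult, <- RPow_abs.
      apply Rmult_le_compat; [apply Rabs_pos|apply pow_le, Rabs_pos|apply HM|].
      apply pow_incr. split; [apply Rabs_pos|].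
      rewrite Rabs_mult, (Rabs_pos_eq u) by lra. nra.
    - apply (@RInt_correct R_CompleteNormedModule).
      apply (ex_RInt_section (fun t u => h t u * (t * u) ^ n)).
      apply (continuity_2d_integrand h (fun t => t ^ n)); assumption. }
  rewrite Rpow_mult_distr.
  replace (t * I1 + b t * (alpha ^ n * t ^ n) - c * alpha ^ n * t ^ n)
    with (t * I1 + (b t - c) * (alpha ^ n * t ^ n)) by ring.
  eapply Rle_trans; [apply Rabs_triang|].
  rewrite !Rabs_mult, <- (RPow_abs alpha), <- (RPow_abs t), (Rabs_pos_eq alpha) by lra.
  pose proof (abs_power_nonneg t eps) as Hp.
  assert (He1 : exp (Rabs t) <= exp (mu * Rabs t)) by (apply exp_le; nra).
  assert (He2 : 1 <= exp (mu * Rabs t)) by (rewrite <- exp_0 at 1; apply exp_le; nra).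
  assert (Hw1 : Rabs t * Rabs t ^ n <= weight n eps mu t).
  { unfold weight. rewrite (Rmult_comm (Rabs t)), Rmult_assoc.
    apply Rmult_le_compat_l; [exact Htn|].
    eapply Rle_trans; [apply (Rabs_le_abs_power_exp t eps He)|].
    apply Rmult_le_compat_l; assumption. }
  assert (Hw2 : abs_power t eps * Rabs t ^ n <= weight n eps mu t).
  { unfold weight. assert (0 <= Rabs t ^ n * abs_power t eps) by nra. nra. }
  assert (Han : 0 < alpha ^ n <= 1).
  { split; [apply pow_lt; lra|]. rewrite <- (pow1 n). apply pow_incr. lra. }
  assert (H1 : Rabs t * Rabs I1 <= M * weight n eps mu t).
  { apply Rle_trans with (Rabs t * (M * Rabs t ^ n)).
    - apply Rmult_le_compat_l; assumption.
    - replace (Rabs t * (M * Rabs t ^ n)) with (M * (Rabs t * Rabs t ^ n)) by ring.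
      apply Rmult_le_compat_l; assumption. }
  assert (H2 : Rabs (b t - c) * (alpha ^ n * Rabs t ^ n) <= Rabs L * weight n eps mu t).
  { apply Rle_trans with (Rabs L * abs_power t eps * (1 * Rabs t ^ n)).
    - apply Rmult_le_compat; [apply Rabs_pos|nra| |].
      + eapply Rle_trans; [exact Hb|]. apply Rmult_le_compat_r; [exact Hp|apply Rle_abs].
      + apply Rmult_le_compat_r; [exact Htn|lra].
    - replace (Rabs L * abs_power t eps * (1 * Rabs t ^ n))
        with (Rabs L * (abs_power t eps * Rabs t ^ n)) by ring.
      apply Rmult_le_compat_l; [apply Rabs_pos|exact Hw2]. }
  lra.
Qed.

(** An eigenfunction for lam = c alpha^n is a fixed point of x |-> (1/lam) times
    the operator.  The two weight bounds give the contraction constant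
    M / (mu |lam|) + q, which is at most (1 + q) / 2 for [mu] large; the
    iteration starts at t^n. *)
Lemma unit_op_eigenfunction (h : R -> R -> R) (b : R -> R) (c alpha M L q eps : R) (n : nat) :
  (forall t u, continuity_2d_pt h t u) ->
  (forall t u, Rabs (h t u) <= M) ->
  (forall t, continuous b t) ->
  c <> 0 -> 0 < alpha < 1 -> 0 < eps < 1 -> 0 <= q < 1 ->
  (forall t, Rabs (b t - c) <= L * abs_power t eps) ->
  (forall t, Rabs (b t) * abs_power alpha eps <= q * Rabs c) ->
  exists phi C mu, 0 <= C /\ 0 <= mu /\
    (forall t, continuous phi t) /\
    (forall t, c * alpha ^ n * phi t = unit_op h b alpha phi t) /\
    (forall t, Rabs (phi t - t ^ n) <= C * weight n eps mu t).
Proof.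
  intros Hh HM Hb Hc Ha He Hq Hbc Hbq.
  assert (HM0 : 0 <= M) by (eapply Rle_trans; [apply Rabs_pos|apply (HM 0 0)]).
  set (lam := c * alpha ^ n).
  assert (Hlam : lam <> 0).
  { apply Rmult_integral_contrapositive_currified; [exact Hc|apply pow_nonzero; lra]. }
  pose proof (Rabs_pos_lt lam Hlam) as Hl.
  (* Chosen so that M / (mu |lam|) <= (1 - q) / 2. *)
  pose (mu := 1 + 2 * M / (Rabs lam * (1 - q))).
  assert (Hlq : 0 < Rabs lam * (1 - q)) by (apply Rmult_lt_0_compat; lra).
  assert (Hmu : 1 <= mu).
  { unfold mu. assert (0 <= 2 * M / (Rabs lam * (1 - q))); [|lra].
    unfold Rdiv. apply Rmult_le_pos; [lra|]. left. apply Rinv_0_lt_compat, Hlq. }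
  assert (HMmu : M / mu <= (1 - q) / 2 * Rabs lam).
  { apply Rmult_le_reg_r with mu; [lra|].
    replace (M / mu * mu) with M by (field; lra).
    replace ((1 - q) / 2 * Rabs lam * mu) with (M + (1 - q) / 2 * Rabs lam)
      by (unfold mu; field; lra).
    nra. }
  pose (rho := (1 + q) / 2).
  pose (P := fun x t => / lam * unit_op h b alpha x t).
  set (D := / Rabs lam * (M + Rabs L)).
  assert (HD : 0 <= D).
  { apply Rmult_le_pos; [left; apply Rinv_0_lt_compat, Hl|].
    pose proof (Rabs_pos L). lra. }
  assert (Hrho : 0 <= rho < 1) by (unfold rho; lra).
  destruct (weighted_contraction_fixed_point P (weight n eps mu) (fun t => t ^ n) rho D)
    as (phi & Hphic & Hphi & Hphiw).
  - exact Hrho.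
  - apply weight_nonneg.
  - apply weight_locally_bounded; lra.
  - intros x Hx t. apply (continuous_scal_r (/ lam) (unit_op h b alpha x)).
    apply unit_op_continuous; assumption.
  - intros x y E Hx Hy HE Hxy t. unfold P.
    rewrite <- Rmult_minus_distr_l, unit_op_minus by assumption.
    rewrite Rabs_mult, Rabs_inv.
    apply Rmult_le_reg_l with (Rabs lam); [exact Hl|].
    rewrite <- Rmult_assoc, Rinv_r, Rmult_1_l by lra.
    eapply Rle_trans; [apply Rabs_triang|].
    assert (Hz : forall t, continuous (fun t => x t - y t) t).
    { intros s. apply (continuous_minus x y); [apply Hx|apply Hy]. }
    pose proof (volterra_weight_bound h (fun t => x t - y t) n eps mu M E t
      Hh Hz HM ltac:(lra) ltac:(lra) HE Hxy) as H1.
    pose proof (dilation_weight_bound b c alpha q (fun t => x t - y t) n eps mu E t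
      Ha ltac:(lra) HE ltac:(lra) (Hbq t) Hxy) as H2.
    simpl in H1, H2. fold lam in H2.
    pose proof (weight_nonneg n eps mu t) as Hw.
    assert (HEw : 0 <= E * weight n eps mu t) by (apply Rmult_le_pos; assumption).
    assert (H3 : M / mu * E * weight n eps mu t
                 <= (1 - q) / 2 * Rabs lam * E * weight n eps mu t).
    { rewrite (Rmult_assoc (M / mu)), (Rmult_assoc ((1 - q) / 2 * Rabs lam)).
      apply Rmult_le_compat_r; assumption. }
    replace (Rabs lam * (rho * E * weight n eps mu t))
      with ((1 - q) / 2 * Rabs lam * E * weight n eps mu t
            + q * Rabs lam * E * weight n eps mu t) by (unfold rho; field).
    lra.
  - intros t. apply continuity_pt_filterlim, derivable_continuous_pt, derivable_pt_pow.
  - exact HD.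
  - intros t. unfold P, D.
    replace (/ lam * unit_op h b alpha (fun t => t ^ n) t - t ^ n)
      with (/ lam * (unit_op h b alpha (fun t => t ^ n) t - lam * t ^ n))
      by (field; exact Hlam).
    rewrite Rabs_mult, Rabs_inv, Rmult_assoc.
    apply Rmult_le_compat_l; [left; apply Rinv_0_lt_compat, Hl|].
    apply unit_op_pow_defect; auto.
  - exists phi, (D / (1 - rho)), mu. repeat split; try assumption; try lra.
    + unfold Rdiv. apply Rmult_le_pos; [exact HD|].
      left. apply Rinv_0_lt_compat. lra.
    + intros t. rewrite <- (Hphi t) at 1. unfold P. field. exact Hlam.
Qed.

(** * Extension of the data from [-T,T] to the line *)

Definition clamp (a b t : R) : R := Rmax a (Rmin b t).

Lemma clamp_bounds (a b t : R) : a <= b -> a <= clamp a b t <= b.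
Proof.
  intros Hab. unfold clamp, Rmax, Rmin.
  destruct (Rle_dec b t); destruct (Rle_dec a _); lra.
Qed.

Lemma clamp_id (a b t : R) : a <= t <= b -> clamp a b t = t.
Proof.
  intros Ht. unfold clamp, Rmax, Rmin.
  destruct (Rle_dec b t); destruct (Rle_dec a _); lra.
Qed.

Lemma clamp_idem (a b t : R) : a <= b -> clamp a b (clamp a b t) = clamp a b t.
Proof.
  intros Hab. apply clamp_id, clamp_bounds, Hab.
Qed.

Lemma Rabs_clamp_le (T t : R) : 0 <= T -> Rabs (clamp (- T) T t) <= Rabs t.
Proof.
  intros HT. unfold clamp, Rmax, Rmin, Rabs.
  repeat destruct (Rle_dec _ _); repeat destruct (Rcase_abs _); lra.
Qed.

Lemma clamp_nonexpansive (a b s t : R) :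
  Rabs (clamp a b s - clamp a b t) <= Rabs (s - t).
Proof.
  unfold clamp, Rmax, Rmin, Rabs.
  repeat destruct (Rle_dec _ _); repeat destruct (Rcase_abs _); lra.
Qed.

Lemma continuous_clamp (a b t : R) : continuous (clamp a b) t.
Proof.
  apply continuous_R_eps. intros e. exists e. intros s Hs.
  eapply Rle_lt_trans; [apply clamp_nonexpansive|exact Hs].
Qed.

(** Precomposing with a continuous map into [D] turns continuity relative to [D]
    into unrestricted continuity. *)
Lemma continuous_on_comp {U V W : UniformSpace} (D : V -> Prop) (f : V -> W) (g : U -> V)
    (x : U) :
  continuous_on D f -> continuous g x -> (forall y, D (g y)) ->
  continuous (fun y => f (g y)) x.
Proof.
  intros Hf Hg HD. unfold continuous.
  apply filterlim_comp with (G := within D (locally (g x))); [|apply Hf, HD].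
  intros Q HQ. unfold within in HQ. apply Hg in HQ.
  unfold filtermap in *. revert HQ. apply filter_imp. intros y Hy. apply Hy, HD.
Qed.

(** All points (t, t v) with 0 <= v <= 1 lie in the domain where [K] is
    continuous, for either sign of t; clamping t and u makes the function
    continuous and bounded on the whole plane. *)
Definition clamped_kernel (T : R) (K : R -> R -> R) (t u : R) : R :=
  K (clamp (- T) T t) (clamp (- T) T t * clamp 0 1 u).

Lemma kernel_domain_ray (t v : R) : 0 <= v <= 1 -> kernel_domain (t, t * v).
Proof.
  intros Hv. unfold kernel_domain. simpl.
  destruct (Rle_dec 0 t); [left|right]; nra.
Qed.

Lemma clamped_kernel_continuous (T : R) (K : R -> R -> R) :
  continuous_on kernel_domain (fun p : R * R => K (fst p) (snd p)) ->
  forall t u, continuity_2d_pt (clamped_kernel T K) t u.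
Proof.
  intros HK t u. apply continuity_2d_pt_filterlim.
  pose (g := fun p : R * R => (clamp (- T) T (fst p), clamp (- T) T (fst p) * clamp 0 1 (snd p))).
  assert (H1 : continuous (fun p : R * R => clamp (- T) T (fst p)) (t, u)).
  { apply (continuous_comp (fun p : R * R => fst p) (clamp (- T) T));
      [apply continuous_fst|apply continuous_clamp]. }
  assert (H2 : continuous (fun p : R * R => clamp 0 1 (snd p)) (t, u)).
  { apply (continuous_comp (fun p : R * R => snd p) (clamp 0 1));
      [apply continuous_snd|apply continuous_clamp]. }
  apply (continuous_on_comp (U := prod_UniformSpace R_UniformSpace R_UniformSpace)
           (V := prod_UniformSpace R_UniformSpace R_UniformSpace) (W := R_UniformSpace)
           kernel_domain (fun p : R * R => K (fst p) (snd p)) g (t, u) HK).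
  - apply (continuous_comp_2 (fun p : R * R => clamp (- T) T (fst p))
             (fun p : R * R => clamp (- T) T (fst p) * clamp 0 1 (snd p))
             (fun v w : R => (v, w))); [exact H1| |].
    + exact (continuous_mult _ _ _ H1 H2).
    + apply continuous_ext with (fun p : R * R => p); [intros []; reflexivity|apply continuous_id].
  - intros p. apply kernel_domain_ray, clamp_bounds. lra.
Qed.

Lemma clamped_kernel_bounded (T : R) (K : R -> R -> R) :
  0 <= T ->
  continuous_on kernel_domain (fun p : R * R => K (fst p) (snd p)) ->
  exists M, forall t u, Rabs (clamped_kernel T K t u) <= M.
Proof.
  intros HT HK.
  destruct (continuity_2d_bounded (clamped_kernel T K) (- T) T 0 1) as [M HM].
  { intros t u _ _. apply clamped_kernel_continuous, HK. }
  exists M. intros t u.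
  replace (clamped_kernel T K t u)
    with (clamped_kernel T K (clamp (- T) T t) (clamp 0 1 u))
    by (unfold clamped_kernel; rewrite !clamp_idem by lra; reflexivity).
  apply HM; apply clamp_bounds; lra.
Qed.

(** On [-T,T] the clamping changes nothing, and the substitution s = t u (for
    t <> 0) identifies the two integrals.  It is applied from the side of
    [0,1], where the integrand is continuous everywhere: s |-> K t s itself is
    known to be continuous only from one side at an end of the segment between
    0 and t. *)
Lemma opA_clamped (T alpha : R) (K : R -> R -> R) (a x : R -> R) (t : R) :
  continuous_on kernel_domain (fun p : R * R => K (fst p) (snd p)) ->
  (forall t, continuous x t) ->
  sym_interval T t ->
  opA K a alpha x t
  = unit_op (clamped_kernel T K) (fun t => a (clamp (- T) T t)) alpha x t.
Proof.
  intros HK Hx Ht. unfold opA, unit_op. rewrite (clamp_id (- T) T t Ht). f_equal.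
  destruct (Req_dec t 0) as [Ht0|Ht0].
  { rewrite Ht0, Rmult_0_l. apply (RInt_point (V := R_CompleteNormedModule)). }
  set (g := fun u => clamped_kernel T K t u * x (t * u)).
  assert (Hg : is_RInt g (/ t * 0 + 0) (/ t * t + 0) (RInt g 0 1)).
  { replace (/ t * 0 + 0) with 0 by ring. replace (/ t * t + 0) with 1 by (field; exact Ht0).
    apply (@RInt_correct R_CompleteNormedModule).
    apply (ex_RInt_section (fun t u => clamped_kernel T K t u * x (t * u))).
    apply continuity_2d_integrand; [apply clamped_kernel_continuous, HK|exact Hx]. }
  apply (is_RInt_comp_lin g (/ t) 0 0 t) in Hg.
  apply (is_RInt_scal _ 0 t t) in Hg.
  apply is_RInt_unique. eapply is_RInt_ext; [|exact Hg].
  intros s Hs. unfold g, clamped_kernel.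
  change (t * (/ t * (K (clamp (- T) T t) (clamp (- T) T t * clamp 0 1 (/ t * s + 0))
            * x (t * (/ t * s + 0)))) = K t s * x s).
  assert (Hu : 0 <= / t * s + 0 <= 1).
  { assert (Hv : s = t * (/ t * s + 0)) by (field; exact Ht0).
    revert Hv. generalize (/ t * s + 0). intros v Hv. rewrite Hv in Hs.
    revert Hs. unfold Rmin, Rmax. destruct (Rle_dec 0 t); intros Hs; split; nra. }
  rewrite (clamp_id 0 1) by exact Hu. rewrite (clamp_id (- T) T t Ht).
  replace (t * (/ t * s + 0)) with s by (field; exact Ht0).
  field. exact Ht0.
Qed.

Lemma continuous_on_interval_le (T : R) (l : R -> R) :
  0 <= T -> in_C T l -> exists L, forall t, sym_interval T t -> l t <= L.
Proof.
  intros HT Hl.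
  assert (Hc : forall t, continuous (fun t => l (clamp (- T) T t)) t).
  { intros t. apply (continuous_on_comp (sym_interval T) l (clamp (- T) T) t Hl).
    - apply continuous_clamp.
    - intros s. apply clamp_bounds. lra. }
  destruct (continuity_ab_maj (fun t => l (clamp (- T) T t)) (- T) T) as [m [Hm _]]; [lra| |].
  { intros t _. apply continuity_pt_filterlim, Hc. }
  exists (l (clamp (- T) T m)). intros t Ht. specialize (Hm t Ht). simpl in Hm.
  rewrite (clamp_id (- T) T t Ht) in Hm. exact Hm.
Qed.

(** * Asymptotics at 0 and the eigenfunctions *)

(** Divided by |t|^n the bound becomes C |t|^eps exp(mu |t|), which tends to 0. *)
Lemma equiv_pow_of_weight_bound (phi : R -> R) (n : nat) (C eps mu : R) :
  0 <= C -> 0 < eps -> 0 <= mu ->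
  (forall t, Rabs (phi t - t ^ n) <= C * weight n eps mu t) ->
  equiv_pow_at_0 phi n.
Proof.
  intros HC He Hmu Hphi. apply is_lim_spec. intros e.
  pose proof (cond_pos e) as He0. pose proof (exp_pos mu) as Hexp.
  set (B := (C + 1) * exp mu).
  assert (HB : 0 < B) by (unfold B; apply Rmult_lt_0_compat; lra).
  destruct (abs_power_small eps (e / (2 * B)) He) as [d Hd].
  { apply Rdiv_lt_0_compat; lra. }
  assert (Hd1 : 0 < Rmin d 1) by (apply Rmin_pos; [apply cond_pos|lra]).
  exists (mkposreal _ Hd1). intros t Ht Ht0.
  change (Rabs (t - 0) < Rmin d 1) in Ht. rewrite Rminus_0_r in Ht.
  assert (Ht1 : Rabs t < d) by (eapply Rlt_le_trans; [exact Ht|apply Rmin_l]).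
  assert (Ht2 : Rabs t < 1) by (eapply Rlt_le_trans; [exact Ht|apply Rmin_r]).
  pose proof (pow_nonzero t n Ht0) as Htn.
  pose proof (Rabs_pos_lt _ Htn) as Htn'.
  replace (phi t / t ^ n - 1) with ((phi t - t ^ n) / t ^ n) by (field; exact Htn).
  rewrite Rabs_div by exact Htn.
  apply Rmult_lt_reg_r with (Rabs (t ^ n)); [exact Htn'|].
  unfold Rdiv. rewrite Rmult_assoc, Rinv_l, Rmult_1_r by lra.
  eapply Rle_lt_trans; [apply Hphi|]. unfold weight. rewrite RPow_abs.
  assert (Hp : abs_power t eps * exp (mu * Rabs t) <= e / (2 * B) * exp mu).
  { apply Rmult_le_compat; [apply abs_power_nonneg|left; apply exp_pos|apply Hd, Ht1|].
    apply exp_le. pose proof (Rabs_pos t). nra. }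
  assert (Hq : C * (abs_power t eps * exp (mu * Rabs t)) < e).
  { apply Rle_lt_trans with ((C + 1) * (e / (2 * B) * exp mu)).
    - apply Rmult_le_compat; [exact HC| |lra|exact Hp].
      apply Rmult_le_pos; [apply abs_power_nonneg|left; apply exp_pos].
    - replace ((C + 1) * (e / (2 * B) * exp mu)) with (e / 2); [lra|].
      unfold B. field. lra. }
  nra.
Qed.

Lemma equiv_pow_nonzero (T : R) (phi : R -> R) (n : nat) :
  0 < T -> equiv_pow_at_0 phi n -> exists t, sym_interval T t /\ phi t <> 0.
Proof.
  intros HT Hphi. apply is_lim_spec in Hphi.
  destruct (Hphi (mkposreal 1 Rlt_0_1)) as [d Hd]. simpl in Hd.
  assert (Hm : 0 < Rmin d T) by (apply Rmin_pos; [apply cond_pos|exact HT]).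
  pose proof (Rmin_l d T) as Hm1. pose proof (Rmin_r d T) as Hm2.
  exists (Rmin d T / 2). split; [unfold sym_interval; lra|]. intros H0.
  assert (Hb : ball 0 d (Rmin d T / 2)).
  { change (Rabs (Rmin d T / 2 - 0) < d). rewrite Rminus_0_r, Rabs_pos_eq; lra. }
  specialize (Hd _ Hb ltac:(lra)). rewrite H0 in Hd.
  unfold Rdiv in Hd. rewrite Rmult_0_l, Rminus_0_l, Rabs_Ropp, Rabs_R1 in Hd. lra.
Qed.

Theorem mainTheorem1 :
  forall (T alpha : R) (K : R -> R -> R) (a : R -> R),
    0 < T ->
    0 < alpha < 1 ->
    continuous_on kernel_domain (fun p : R * R => K (fst p) (snd p)) ->
    (forall t : R, continuous a t) ->
    a 0 <> 0 ->
    (exists (eps : R) (l : R -> R) (q : R),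
        0 < eps < 1 /\
        in_C T l /\
        q < 1 /\
        (forall t, sym_interval T t ->
           Rabs (a t - a 0) <= l t * abs_power t eps /\
           Rabs (a t) * abs_power alpha eps <= q * Rabs (a 0))) ->
    forall n : nat,
      is_eigenvalue T (opA K a alpha) (a 0 * alpha ^ n) /\
      exists phi : R -> R,
        is_eigenfunction T (opA K a alpha) (a 0 * alpha ^ n) phi /\
        equiv_pow_at_0 phi n.
Proof.
  intros T alpha K a HT Halpha HK Ha Ha0 (eps & l & q & Heps & Hl & Hq & Hbound) n.
  assert (Hc : forall t, sym_interval T (clamp (- T) T t)).
  { intros t. apply clamp_bounds. lra. }
  destruct (continuous_on_interval_le T l (Rlt_le _ _ HT) Hl) as [L HL].
  destruct (clamped_kernel_bounded T K (Rlt_le _ _ HT) HK) as [M HM].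
  (* At t = 0 the bound on a reads |a 0| alpha^eps <= q |a 0|. *)
  assert (Hq0 : 0 <= q).
  { destruct (Hbound 0) as [_ H]; [unfold sym_interval; lra|].
    pose proof (Rabs_pos_lt _ Ha0). pose proof (abs_power_nonneg alpha eps). nra. }
  destruct (unit_op_eigenfunction (clamped_kernel T K) (fun t => a (clamp (- T) T t))
              (a 0) alpha M (Rabs L) q eps n)
    as (phi & C & mu & HC & Hmu & Hphic & Hphi & Hphiw); try assumption.
  - apply clamped_kernel_continuous, HK.
  - intros t. apply (continuous_comp (clamp (- T) T) a); [apply continuous_clamp|apply Ha].
  - lra.
  - intros t. eapply Rle_trans; [apply (Hbound _ (Hc t))|].
    apply Rle_trans with (Rabs L * abs_power (clamp (- T) T t) eps).
    + apply Rmult_le_compat_r; [apply abs_power_nonneg|].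
      eapply Rle_trans; [apply (HL _ (Hc t))|apply Rle_abs].
    + apply Rmult_le_compat_l; [apply Rabs_pos|].
      apply abs_power_le; [lra|apply Rabs_clamp_le; lra].
  - intros t. apply (Hbound _ (Hc t)).
  - assert (Hequiv : equiv_pow_at_0 phi n).
    { apply equiv_pow_of_weight_bound with C eps mu; try assumption; lra. }
    assert (Heig : is_eigenfunction T (opA K a alpha) (a 0 * alpha ^ n) phi).
    { split; [|split].
      - intros t _. eapply filterlim_filter_le_1; [apply filter_le_within|apply Hphic].
      - apply equiv_pow_nonzero with n; assumption.
      - intros t Ht. rewrite (opA_clamped T) by assumption. apply Hphi. }
    split; [exists phi; exact Heig|exists phi; split; assumption].
Qed.
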